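(* For all integers $k\geq 1$ and all real $0\leq p\leq 2^{-(k+1)}$, $$C_{k,p}\geq 1-\frac{1-p}{2^{k+1}-1}\log_2\left(\frac{2-2p}{1+2p(2^k-1)}\right)-p\log_2\left(\frac{2p(2^{k+1}-1)}{1+2p(2^k-1)}\right),$$ where $C_{k,p}$ is the capacity of the $(0,k,p)$-RLL semiconstrained system.
   Context: For finite words $\tau,\omega$ over $\{0,1\}$ with $|\tau|\leq|\omega|$, $T(\tau,\omega)=\frac{1}{|\omega|-|\tau|+1}\,\#\{0\leq i\leq |\omega|-|\tau| : \omega_i\omega_{i+1}\cdots\omega_{i+|\tau|-1}=\tau\}$ is the frequency of $\tau$ as a (contiguous) subword of $\omega$; if $|\tau|>|\omega|$ then $T(\tau,\omega)=0$. Let $1^{k+1}$ denote the word of $k+1$ consecutive ones. The $(0,k,p)$-RLL semiconstrained system is the set of all finite binary words $\omega$ with $T(1^{k+1},\omega)\leq p$. Let $\mathcal{B}_n=\{\omega\in\{0,1\}^n : T(1^{k+1},\omega)\leq p\}$. Its capacity is $C_{k,p}=\limsup_{n\to\infty}\frac1n\log_2|\mathcal{B}_n|$. The usual convention $0\log_2 0=0$ is used when $p=0$. *)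

(* Defs.v *)
From HB Require Import structures.
From mathcomp Require Import all_boot all_order all_algebra.
From mathcomp Require Import all_classical all_reals all_analysis.

Set Implicit Arguments.
Unset Strict Implicit.
Unset Printing Implicit Defensive.

Import Order.TTheory GRing.Theory Num.Theory.
Import numFieldNormedType.Exports.

Local Open Scope ring_scope.

(* Since [ln 0 = 0] in the library, [0 * log2 0 = 0]. *)
Definition log2 (R : realType) (x : R) : R := ln x / ln 2%:R.

(* Binary words are sequences of booleans, [true] standing for the letter 1.
   Subtraction is truncated, so the index range 0 .. |omega| - |tau| is only
   meaningful when |tau| <= |omega|. *)
Definition occurrences (tau omega : seq bool) : nat :=
  #|[set i : 'I_(size omega - size tau).+1 |
      take (size tau) (drop i omega) == tau]|.

Definition frequency (R : realType) (tau omega : seq bool) : R :=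
  if (size tau <= size omega)%N then
    (occurrences tau omega)%:R / (size omega - size tau + 1)%:R
  else 0.

Definition rll (R : realType) (k : nat) (p : R) : {pred seq bool} :=
  [pred omega | frequency R (nseq k.+1 true) omega <= p].

Definition rll_words (R : realType) (k : nat) (p : R) (n : nat) :
    {set n.-tuple bool} :=
  [set omega : n.-tuple bool | (omega : seq bool) \in rll k p].

(* The limit superior is taken in the extended reals, where it always exists;
   the term at [n = 0], where [n%:R^-1 = 0], does not affect it. *)
Definition capacity (R : realType) (k : nat) (p : R) : \bar R :=
  limn_esup (fun n : nat => (n%:R^-1 * log2 (#|rll_words k p n|%:R : R))%:E).

(* Main.v *)
Require Import Defs.
From mathcomp Require Import all_boot all_order all_algebra.
From mathcomp Require Import all_classical all_reals all_analysis.
From mathcomp Require Import ring lra zify.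

Import Order.TTheory GRing.Theory Num.Theory.
Import numFieldNormedType.Exports.
Local Open Scope ring_scope.

(** Words are generated by prepending letters: a fair coin decides each new
    letter, except that after k ones a coin of bias q is used.  This Markov chain
    visits the states "at least k leading ones" with frequency
    a = 1 / (1 + 2 (1 - q) (2^k - 1)), hence creates 1^{k+1} with frequency a q,
    and its entropy rate is 1 - a (1 - H(q)).  Choosing q so that a q = p turns
    this rate into the claimed bound.

    The number of visits and the number of occurrences are martingales up to linear
    drifts and a bounded correction, so by Chebyshev words of length n are typical
    with probability at least 1/2.  A typical word has probability at most
    2^{-n (rate - o(1))}, which bounds the number of typical words from below.
    Typical words only satisfy the frequency constraint up to o(1): for p > 0 one
    runs the argument with p' < p and lets p' tend to p, while for p = 0 the chain
    never produces 1^{k+1}. *)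

(** * Sums over words, logarithms and limits *)

Section Preliminaries.
Set Implicit Arguments.
Unset Strict Implicit.

Lemma sum_tuple_cons (V : nmodType) (F : seq bool -> V) n :
  \sum_(w : n.+1.-tuple bool) F w
    = \sum_(w : n.-tuple bool) (F (true :: w) + F (false :: w)).
Proof.
rewrite (reindex (fun bw : bool * n.-tuple bool => cons_tuple bw.1 bw.2)) /=.
  rewrite -(pair_big xpredT xpredT (fun b (w : n.-tuple bool) => F (b :: w))) /=.
  by rewrite big_bool big_split.
exists (fun w => (thead w, behead_tuple w)) => [[b w] _|w _] /=.
  by congr pair; apply/val_inj.
by rewrite [in RHS](tuple_eta w); apply/val_inj.
Qed.

(** For [x <= 0] this is positivity of the exponential; the value [x = 0] is what lets [q = 0]
    through later. *)
Lemma le_expR_ln (R : realType) (x : R) : x <= expR (ln x).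
Proof.
have [x0|x0] := ltP 0 x; first by rewrite lnK.
exact: le_trans x0 (ltW (expR_gt0 _)).
Qed.

Lemma limn_esup_ge (R : realType) (u : nat -> \bar R) (c : \bar R) :
  (\forall n \near \oo, (c <= u n)%E)%classic -> (c <= limn_esup u)%E.
Proof.
move=> cu; rewrite /limn_esup limf_esupE; apply: le_ereal_inf_tmp => _ [V nV <-].
near \oo%classic => n; apply: (@le_trans _ _ (u n)); first by near: n.
apply: ereal_sup_ubound; exists n => //; near: n; exact: nV.
Unshelve. all: by end_near. Qed.

Lemma near_infty_mul (R : realType) (a c : R) : 0 < a ->
  (\forall n \near \oo, c <= a * n%:R)%classic.
Proof.
move=> a0; near=> n; rewrite mulrC -ler_pdivrMr //.
by near: n; exact: nbhs_infty_ger.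
Unshelve. all: by end_near. Qed.

End Preliminaries.

(** * Recursive counting of runs of ones *)

Section Words.
Set Implicit Arguments.
Unset Strict Implicit.
Variable k : nat.

Definition lead (w : seq bool) : nat := find negb w.

(* A visit is counted at each letter prepended to a word starting with 1^k. *)
Fixpoint visits (w : seq bool) : nat :=
  if w is _ :: w' then ((k <= lead w') + visits w')%N else 0.

Fixpoint occ (w : seq bool) : nat :=
  if w is b :: w' then ((b && (k <= lead w')) + occ w')%N else 0.

Lemma leq_lead j w : (j <= lead w)%N = (take j w == nseq j true).
Proof. by elim: w j => [|[] w IH] [|j] //=; rewrite ltnS IH. Qed.

Lemma occurrencesE w : occurrences (nseq k.+1 true) w = occ w.
Proof.
have sumE v : (\sum_(i < size v) (take k.+1 (drop i v) == nseq k.+1 true) = occ v)%N.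
  elim: v => [|b v IH] /=; first by rewrite big_ord0.
  by rewrite big_ord_recl /= -IH leq_lead eqseq_cons eqb_id.
rewrite /occurrences (size_nseq k.+1 true) -sumE cardsE -sum1_card big_mkcond /=.
under eq_bigr do rewrite unfold_in /=.
set F := fun i : nat => nat_of_bool (take k.+1 (drop i w) == nseq k.+1 true).
rewrite (eq_bigr (fun i : ordinal _ => F i)); last first.
  move=> i _; rewrite -[eqseq _ _]/(take k.+1 (drop i w) == nseq k.+1 true).
  by rewrite /F; case: eqP.
rewrite -[RHS]/(\sum_(i < size w) F i)%N.
(* A window starting later is cut short by the end of the word, so both index ranges can be widened
   to [0 .. size w]. *)
have F0 i : (size w - k.+1 < i)%N -> F i = 0.
  move=> lti; rewrite /F; case: eqP => // /(congr1 size).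
  by rewrite size_take_min size_drop /= size_nseq => /minn_idPl; lia.
transitivity (\sum_(i < (size w).+1) F i)%N.
  rewrite [LHS](big_ord_widen (size w).+1 F) ?ltnS ?leq_subr // [LHS]big_mkcond.
  by apply: eq_bigr => i _; case: ltnP => // /F0.
by rewrite big_ord_recr /= /F drop_size addn0.
Qed.

End Words.

(** * The Markov chain and its word probabilities *)

Section Chain.
Set Implicit Arguments.
Unset Strict Implicit.
Variables (R : realType) (k : nat) (q : R).
Hypotheses (q0 : 0 <= q) (q1 : q < 1).

Definition bias (w : seq bool) : R := if (k <= lead w)%N then q else 2^-1.

Fixpoint weight (w : seq bool) : R :=
  if w is b :: w' then (if b then bias w' else 1 - bias w') * weight w' else 1.

Lemma bias_ge0 w : 0 <= bias w.
Proof. by have h0 := q0; rewrite /bias; case: ifP => _; lra. Qed.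

Lemma bias_le1 w : bias w <= 1.
Proof. by have h1 := q1; rewrite /bias; case: ifP => _; lra. Qed.

Lemma weight_ge0 w : 0 <= weight w.
Proof.
elim: w => //= b w IH; rewrite mulr_ge0 //.
by case: b; rewrite ?subr_ge0 ?bias_ge0 ?bias_le1.
Qed.

Lemma sum_weight n : \sum_(w : n.-tuple bool) weight w = 1.
Proof.
elim: n => [|n IH].
  rewrite (bigD1 [tuple]) //= big1 ?addr0 // => w /eqP[].
  exact: tuple0.
rewrite sum_tuple_cons -[RHS]IH; apply: eq_bigr => w _ /=; ring.
Qed.

(* The increments of a martingale are orthogonal. *)
Lemma sum_weight_martingale (f : seq bool -> R) C n : f [::] = 0 ->
    (forall w, bias w * (f (true :: w) - f w)
               + (1 - bias w) * (f (false :: w) - f w) = 0) ->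
    (forall b w, (f (b :: w) - f w) ^+ 2 <= C) ->
  \sum_(w : n.-tuple bool) weight w * f w ^+ 2 <= n%:R * C.
Proof.
move=> f0 fm fC; elim: n => [|n IH].
  rewrite mul0r big1 // => w _.
  by rewrite [w]tuple0 /= f0 expr0n mulr0.
rewrite (sum_tuple_cons (fun w => weight w * f w ^+ 2)) -natr1 mulrDl mul1r.
have {2}-> : C = \sum_(w : n.-tuple bool) weight w * C.
  by rewrite -mulr_suml sum_weight mul1r.
apply: (le_trans _ (lerD IH (lexx _))); rewrite -big_split; apply: ler_sum => w _ /=.
rewrite -mulrA -[X in _ + X]mulrA ![_ * (weight w * _)]mulrCA -!mulrDr.
apply: ler_wpM2l; first exact: weight_ge0.
have c0 := bias_ge0 w; have c1 := bias_le1 w.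
have {}fm := fm w; have x1 := fC true w; have x2 := fC false w.
move: (bias w) (f (true :: w)) (f (false :: w)) (f w) fm x1 x2 c0 c1 => c x y z.
move=> drift xC yC c0 c1.
(* Expansion around the old value [z]: the cross term is the drift, and a mean of squared increments
   remains. *)
have -> : c * x ^+ 2 + (1 - c) * y ^+ 2
  = z ^+ 2 + 2 * z * (c * (x - z) + (1 - c) * (y - z))
    + (c * (x - z) ^+ 2 + (1 - c) * (y - z) ^+ 2) by ring.
rewrite drift mulr0 addr0 lerD2l.
have -> : C = c * C + (1 - c) * C by ring.
by apply: lerD; apply: ler_wpM2l => //; lra.
Qed.

(** * Stationary frequency of visits and second moments of the deviations *)

Definition stat : R := (1 + 2 * (1 - q) * (2 ^+ k - 1))^-1.

Lemma expr2_ge1 j : 1 <= 2 ^+ j :> R.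
Proof. by apply: exprn_ege1; lra. Qed.

Lemma stat_den_ge1 : 1 <= 1 + 2 * (1 - q) * (2 ^+ k - 1).
Proof. by rewrite lerDl mulr_ge0 ?subr_ge0 ?expr2_ge1 // mulr_ge0 ?subr_ge0 ?ltW. Qed.

Lemma stat_gt0 : 0 < stat.
Proof. by rewrite invr_gt0; apply: lt_le_trans stat_den_ge1. Qed.

Lemma stat_le1 : stat <= 1.
Proof. by rewrite invf_le1 ?stat_den_ge1 //; apply: lt_le_trans stat_den_ge1. Qed.

(* Solves the Poisson equation that makes [visits_dev] below a martingale. *)
Definition pot (w : seq bool) : R := 2 * stat * (2 ^+ minn k (lead w) - 1).

Lemma pot_ge0 w : 0 <= pot w.
Proof.
by rewrite mulr_ge0 ?subr_ge0 ?expr2_ge1 // mulr_ge0 // ltW ?stat_gt0.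
Qed.

Lemma pot_le w : pot w <= 2 ^+ k.+1.
Proof.
rewrite /pot exprS -mulrA; apply: ler_pM => //.
- by rewrite mulr_ge0 ?subr_ge0 ?expr2_ge1 // ltW ?stat_gt0.
- rewrite -[leRHS]mul1r ler_pM ?subr_ge0 ?expr2_ge1 ?stat_le1 // ?(ltW stat_gt0) //.
  rewrite lerBlDr (@le_trans _ _ (2 ^+ k)) ?lerDl //.
  by rewrite ler_weXn2l ?geq_minl //; lra.
Qed.

(** Each visit creates an occurrence with conditional probability [q], so this is a martingale. *)
Definition occ_dev (w : seq bool) : R := (occ k w)%:R - q * (visits k w)%:R.

Definition visits_dev (w : seq bool) : R :=
  (visits k w)%:R - stat * (size w)%:R + pot w.

Lemma sum_weight_occ_dev n :
  \sum_(w : n.-tuple bool) weight w * occ_dev w ^+ 2 <= n%:R.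
Proof.
rewrite -[leRHS]mulr1; apply: sum_weight_martingale.
- by rewrite /occ_dev mulr0 subrr.
- move=> w; rewrite /occ_dev /bias /=; case: ifP => _ /=; rewrite !natrD /=; ring.
move=> b w; rewrite /occ_dev /= !natrD.
set d := (X in X ^+ 2); have -> : d = (b && (k <= lead w)%N)%:R - q * (k <= lead w)%N%:R
  by rewrite /d; ring.
have := q0; have := q1; rewrite expr2 {d}.
by case: b; case: (leqP k _) => _ /= h1 h0; nra.
Qed.

Lemma sum_weight_visits_dev n :
  \sum_(w : n.-tuple bool) weight w * visits_dev w ^+ 2
    <= n%:R * (1 + 2 ^+ k.+1) ^+ 2.
Proof.
apply: sum_weight_martingale.
- by rewrite /visits_dev /pot /= minn0 expr0 !subrr !mulr0 subrr addr0.
- move=> w; rewrite /visits_dev /bias /pot /= minn0 expr0 subrr mulr0 addr0.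
  have D0 : 1 + 2 * (1 - q) * (2 ^+ k - 1) != 0.
    by rewrite gt_eqF //; apply: lt_le_trans stat_den_ge1.
  (* A zero resets the potential to 0. A one keeps it when there are at least [k] leading ones and
     raises it by [2 * stat * 2 ^+ lead w] otherwise. *)
  case: (leqP k (lead w)) => [kl|lk] /=.
    rewrite (minn_idPl _) ?leqW // !natrD -[(size w).+1%:R]natr1 /stat.
    by field.
  rewrite (minn_idPr lk) add0n exprS -[(size w).+1%:R]natr1.
  by field.
(* The visit term minus [stat] contributes at most 1 in absolute value, the change of potential at
   most [2 ^+ k.+1]. *)
move=> b w; rewrite -real_normK ?num_real ?ler_pXn2r ?nnegrE ?addr_ge0 ?exprn_ge0 //.
have := pot_ge0 w; have := pot_le w.
have := pot_ge0 (b :: w); have := pot_le (b :: w).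
have := stat_gt0; have := stat_le1.
rewrite /visits_dev /= natrD -[(size w).+1%:R]natr1 => s1 s0 p1 p0 p1' p0'.
set d := (X in `|X|); have -> : d = (k <= lead w)%N%:R - stat + (pot (b :: w) - pot w)
  by rewrite /d; ring.
by rewrite ler_norml; case: (k <= lead w)%N => /=; lra.
Qed.

(* These use [ln 0 = 0]: at [q = 0] the bound on the weights below stays true
   because a word containing 1^{k+1} has weight 0. *)
Definition slope : R := ln 2 + ln (1 - q).
Definition tilt : R := ln q - ln (1 - q).

Definition log_weight_bound (w : seq bool) : R :=
  slope * (visits k w)%:R + tilt * (occ k w)%:R - ln 2 * (size w)%:R.

Lemma weight_le_expR w : weight w <= expR (log_weight_bound w).
Proof.
rewrite /log_weight_bound.
elim: w => [|b w IH] /=; first by rewrite !mulr0 addr0 subrr expR0.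
set x := (X in _ <= expR X).
have -> : x = (slope * (k <= lead w)%N%:R + tilt * (b && (k <= lead w)%N)%:R - ln 2)
    + (slope * (visits k w)%:R + tilt * (occ k w)%:R - ln 2 * (size w)%:R).
  by rewrite /x !natrD -[(size w).+1%:R]natr1; ring.
rewrite expRD; apply: ler_pM => //.
- by case: b {x}; rewrite ?subr_ge0 ?bias_ge0 ?bias_le1.
- exact: weight_ge0.
rewrite /bias {x}; case: (k <= lead w)%N; rewrite ?andbF ?andbT.
  case: b => /=; rewrite /slope /tilt !mulr1 ?mulr0.
    by rewrite [X in expR X](_ : _ = ln q) ?le_expR_ln //; ring.
  by rewrite [X in expR X](_ : _ = ln (1 - q)) ?le_expR_ln //; ring.
rewrite !mulr0 addr0 sub0r expRN lnK ?posrE //.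
by case: b => //; have -> : 1 - 2^-1 = 2^-1 :> R by field.
Qed.

Lemma weight_q0_occ w : q = 0 -> weight w != 0 -> occ k w = 0.
Proof.
move=> q00; elim: w => //= b w IH; rewrite mulf_eq0 negb_or => /andP[+ /IH ->].
by rewrite /bias; case: b; case: (k <= lead w)%N => //=; rewrite q00 eqxx.
Qed.

(* The entropy rate of the chain, in nats. *)
Definition rate : R := ln 2 - stat * (slope + q * tilt).

(** * Typical words, their number, and the capacity *)

(** Chebyshev for both deviations at once: the size hypothesis makes their summed second moments at
    most half of [(d * n%:R) ^+ 2]. *)
Lemma typical_mass n d : 0 < d -> (0 < n)%N ->
    2 * (1 + (1 + 2 ^+ k.+1) ^+ 2) <= d ^+ 2 * n%:R ->
  2^-1 <= \sum_(w : n.-tuple bool |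
      (`|occ_dev w| <= d * n%:R) && (`|visits_dev w| <= d * n%:R)) weight w.
Proof.
move=> d0 n0 nbig; set P := (X in \sum_(w | X w) _).
have n0' : 0 < n%:R :> R by rewrite ltr0n.
have := sum_weight n; rewrite (bigID P) /= => sum1.
suff : \sum_(w : n.-tuple bool | ~~ P w) weight w <= 2^-1 by lra.
have dn0 : 0 < d * n%:R by exact: mulr_gt0.
rewrite -(ler_pM2l (exprn_gt0 2 dn0)) mulr_sumr.
apply: (@le_trans _ _ (\sum_(w : n.-tuple bool)
    (weight w * occ_dev w ^+ 2 + weight w * visits_dev w ^+ 2))).
  rewrite [leLHS]big_mkcond; apply: ler_sum => w _.
  have w0 := weight_ge0 w; case: ifP => [|_]; last first.
    by rewrite addr_ge0 // mulr_ge0 // sqr_ge0.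
  rewrite negb_and -!ltNge -mulrDr [leLHS]mulrC => big.
  apply: ler_wpM2l => //.
  case/orP: big => /ltW big.
    apply: le_trans (_ : occ_dev w ^+ 2 <= _); last by rewrite lerDl sqr_ge0.
    by rewrite -[leRHS]real_normK ?num_real // ler_pXn2r ?nnegrE // ltW.
  apply: le_trans (_ : visits_dev w ^+ 2 <= _); last by rewrite lerDr sqr_ge0.
  by rewrite -[leRHS]real_normK ?num_real // ler_pXn2r ?nnegrE // ltW.
rewrite big_split /=.
apply: le_trans (lerD (sum_weight_occ_dev n) (sum_weight_visits_dev n)) _.
have -> : (d * n%:R) ^+ 2 * 2^-1 = n%:R * (d ^+ 2 * n%:R / 2) by field.
by rewrite -{1}[n%:R]mulr1 -mulrDr ler_pM2l //; lra.
Qed.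

(** With occurrences written as [q] times visits plus [occ_dev], and visits as [stat * n%:R] plus an
    error, the main terms add up to [- rate * n%:R]. The factor 2 comes from absorbing [pot] into
    [d * n%:R]. *)
Lemma log_weight_typical n d w : size w = n -> 2 ^+ k.+1 <= d * n%:R ->
    `|occ_dev w| <= d * n%:R -> `|visits_dev w| <= d * n%:R ->
  log_weight_bound w
    <= (d * (2 * `|slope + q * tilt| + `|tilt|) - rate) * n%:R.
Proof.
move=> wn dn so sv.
have sv' : `|(visits k w)%:R - stat * n%:R| <= 2 * (d * n%:R).
  have -> : (visits k w)%:R - stat * n%:R = visits_dev w - pot w.
    by rewrite /visits_dev wn; ring.
  rewrite mulr_natl mulr2n; apply: le_trans (ler_normB _ _) (lerD sv _).
  by rewrite ger0_norm ?pot_ge0 //; apply: le_trans dn; exact: pot_le.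
have -> : log_weight_bound w = (slope + q * tilt) * ((visits k w)%:R - stat * n%:R)
   + tilt * occ_dev w - rate * n%:R.
  by rewrite /log_weight_bound /rate /occ_dev wn; ring.
rewrite [leRHS]mulrBl lerD2r.
apply: le_trans (ler_norm _) _; apply: le_trans (ler_normD _ _) _; rewrite !normrM.
have := ler_wpM2l (normr_ge0 (slope + q * tilt)) sv'.
have := ler_wpM2l (normr_ge0 tilt) so.
by nra.
Qed.

(** Mass at least 1/2, carried by words that are each exponentially unlikely, needs exponentially
    many words; the factor 1/2 becomes the term [- ln 2]. *)
Lemma rll_words_ge (p : R) n d : 0 < d -> (0 < n)%N ->
    2 * (1 + (1 + 2 ^+ k.+1) ^+ 2) <= d ^+ 2 * n%:R -> 2 ^+ k.+1 <= d * n%:R ->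
    (forall w, size w = n -> weight w != 0 ->
       `|occ_dev w| <= d * n%:R -> `|visits_dev w| <= d * n%:R -> w \in rll k p) ->
  (rate - d * (2 * `|slope + q * tilt| + `|tilt|)) * n%:R - ln 2
    <= ln (#|rll_words k p n|%:R : R).
Proof.
move=> d0 n0 nbig nbig' typ.
set x := (X in X * n%:R - _ <= _).
have : 2^-1 <= #|rll_words k p n|%:R * expR (- x * n%:R).
  apply: le_trans (typical_mass d0 n0 nbig) _.
  rewrite mulr_natl -sumr_const big_mkcond [leRHS]big_mkcond /=.
  apply: ler_sum => w _; rewrite inE.
  have wb : (`|occ_dev w| <= d * n%:R) && (`|visits_dev w| <= d * n%:R) ->
      weight w <= expR (- x * n%:R).
    move=> /andP[so sv]; apply: le_trans (weight_le_expR w) _.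
    by rewrite ler_expR opprB log_weight_typical ?size_tuple.
  case: ifP => [typw|_]; last by case: ifP => // _; rewrite expR_ge0.
  case: ifPn => [_|wB]; first exact: wb.
  have [->//|w0] := eqVneq (weight w) 0.
  by move: typw wB => /andP[so sv]; rewrite typ ?size_tuple.
move=> card_ge.
have card0 : 0 < #|rll_words k p n|%:R :> R.
  by rewrite -(pmulr_lgt0 _ (expR_gt0 (- x * n%:R))) (lt_le_trans _ card_ge).
rewrite -ler_expR expRD expRN !lnK ?posrE //.
by rewrite mulrC -ler_pdivlMr ?expR_gt0 // -expRN -mulNr.
Qed.

Lemma capacity_ge_rate (p : R) d0 : 0 < d0 ->
    (\forall n \near \oo, forall w, size w = n -> weight w != 0 ->
       `|occ_dev w| <= d0 * n%:R -> `|visits_dev w| <= d0 * n%:R -> w \in rll k p)%classic ->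
  ((rate / ln 2)%:E <= capacity k p)%E.
Proof.
move=> d00 typ; apply/lee_subgt0Pr => e e0.
have ln2 : 0 < ln 2 :> R by apply: ln_gt0; lra.
set K := 2 * `|slope + q * tilt| + `|tilt|.
have K0 : 0 <= K by rewrite addr_ge0 // mulr_ge0.
(* The loss [d * K] uses half of [e * ln 2]; the other half absorbs the term [- ln 2] for large [n].
   Taking [K + 1] keeps the denominator positive. *)
pose d := Num.min d0 (e * ln 2 / (2 * (K + 1))).
have d1 : 0 < d by rewrite lt_min d00 divr_gt0 // mulr_gt0 //; lra.
have dd0 : d <= d0 by rewrite ge_min lexx.
have dK : d * K <= e / 2 * ln 2.
  apply: (@le_trans _ _ (d * (K + 1))); first by rewrite ler_pM2l //; lra.
  apply: (@le_trans _ _ (e * ln 2 / (2 * (K + 1)) * (K + 1))).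
    by rewrite ler_pM2r ?ge_min ?lexx ?orbT //; lra.
  by rewrite le_eqVlt; apply/orP; left; apply/eqP; field; lra.
apply: limn_esup_ge; near=> n.
have n0 : (0 < n)%N by near: n; exact: nbhs_infty_gt.
have n0' : 0 < n%:R :> R by rewrite ltr0n.
have en : 1 <= e / 2 * n%:R by near: n; apply: near_infty_mul; lra.
have card_ge : (rate - d * K) * n%:R - ln 2 <= ln (#|rll_words k p n|%:R : R).
  apply: rll_words_ge => //.
  - by near: n; apply: near_infty_mul; rewrite exprn_gt0.
  - by near: n; apply: near_infty_mul.
  move=> w wn w0 so sv.
  have lift x : x <= d * n%:R -> x <= d0 * n%:R.
    by move=> /le_trans; apply; rewrite ler_pM2r.
  by move: w wn w0 {so sv} (lift _ so) (lift _ sv); near: n.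
rewrite -EFinB lee_fin [leRHS]mulrC /log2 -mulrA -invfM ler_pdivlMr ?mulr_gt0 //.
apply: le_trans card_ge.
have -> : (rate / ln 2 - e) * (ln 2 * n%:R) = rate * n%:R - e * (ln 2 * n%:R).
  by field; lra.
have := ler_wpM2r (ltW n0') dK; have := ler_wpM2r (ltW ln2) en; nra.
Unshelve. all: by end_near. Qed.

(** A word of size [n > k] has [n - k] windows of length [k.+1]; a shorter word has frequency 0. *)
Lemma mem_rll (p : R) w : 0 <= p ->
  (occ k w)%:R <= p * ((size w)%:R - k%:R) -> w \in rll k p.
Proof.
move=> p0 wp; rewrite unfold_in /frequency size_nseq occurrencesE.
case: ifP => // kw; rewrite ler_pdivrMr ?ltr0n ?addn1 //.
by rewrite subnSK // natrB // ltnW.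
Qed.

End Chain.

(** * Choice of the bias and the explicit bound *)

Section Bound.
Set Implicit Arguments.
Unset Strict Implicit.
Variables (R : realType) (k : nat).

Definition rll_bound (p : R) : R :=
  1 - (1 - p) / (2 ^+ k.+1 - 1) * log2 ((2 - 2 * p) / (1 + 2 * p * (2 ^+ k - 1)))
    - p * log2 (2 * p * (2 ^+ k.+1 - 1) / (1 + 2 * p * (2 ^+ k - 1))).

(* The bias for which 1^{k+1} occurs with frequency [p]. *)
Definition coin (p : R) : R := p * (2 ^+ k.+1 - 1) / (1 + 2 * p * (2 ^+ k - 1)).

Lemma bound_den_gt0 (p : R) : 0 <= p -> 0 < 1 + 2 * p * (2 ^+ k - 1).
Proof.
by move=> p0; rewrite ltr_pwDl // mulr_ge0 ?subr_ge0 ?expr2_ge1 // mulr_ge0.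
Qed.

Lemma pred_expr2S_gt0 : 0 < 2 ^+ k.+1 - 1 :> R.
Proof. by rewrite subr_gt0 exprn_egt1 //; lra. Qed.

Lemma coinC (p : R) : 0 <= p -> 1 - coin p = (1 - p) / (1 + 2 * p * (2 ^+ k - 1)).
Proof.
move=> p0; rewrite /coin exprS; field.
by rewrite gt_eqF ?bound_den_gt0.
Qed.

Lemma coin_ge0 (p : R) : 0 <= p -> 0 <= coin p.
Proof.
move=> p0; rewrite /coin divr_ge0 ?mulr_ge0 //; first exact: ltW pred_expr2S_gt0.
exact: ltW (bound_den_gt0 p0).
Qed.

Lemma coin_lt1 (p : R) : 0 <= p -> p < 1 -> coin p < 1.
Proof.
by move=> p0 p1; rewrite -subr_gt0 coinC // divr_gt0 ?bound_den_gt0 // subr_gt0.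
Qed.

Lemma stat_coin (p : R) : 0 <= p -> p < 1 ->
  stat k (coin p) = (1 + 2 * p * (2 ^+ k - 1)) / (2 ^+ k.+1 - 1).
Proof.
move=> p0 p1; rewrite /stat coinC //; rewrite -[RHS]invf_div; congr (_^-1).
have D0 := bound_den_gt0 p0.
by rewrite exprS; field; rewrite gt_eqF.
Qed.

Lemma rate_coin (p : R) : 0 <= p -> p < 1 ->
  rate k (coin p) / ln 2 = rll_bound p.
Proof.
move=> p0 p1; have D0 := bound_den_gt0 p0; have M0 := pred_expr2S_gt0.
have ln2 : 0 < ln 2 :> R by apply: ln_gt0; lra.
have c1 : 0 < 1 - coin p by rewrite subr_gt0 coin_lt1.
rewrite /rate stat_coin // /rll_bound /log2.
(* The arguments of the two logarithms are twice the probabilities of the biased coin. *)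
have -> : (2 - 2 * p) / (1 + 2 * p * (2 ^+ k - 1)) = 2 * (1 - coin p).
  by rewrite coinC //; field; rewrite gt_eqF.
have -> : 2 * p * (2 ^+ k.+1 - 1) / (1 + 2 * p * (2 ^+ k - 1)) = 2 * coin p.
  by rewrite /coin; field; rewrite gt_eqF.
(* At [p = 0] the logarithm does not split, but the factor [p] removes it. *)
have -> : p * (ln (2 * coin p) / ln 2) = p * ((ln 2 + ln (coin p)) / ln 2).
  have [->|pn0] := eqVneq p 0; first by rewrite !mul0r.
  by rewrite lnM ?posrE // /coin divr_gt0 // mulr_gt0 // lt_neqAle eq_sym pn0.
rewrite lnM ?posrE // /slope /tilt.
move: (ln (coin p)) (ln (1 - coin p)) => x y.
rewrite /coin exprS in M0 *.
by field; rewrite !gt_eqF.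
Qed.

Lemma capacity_ge_bound (p p' : R) : 0 <= p' -> p' < 1 -> p' < p \/ p' = p /\ p = 0 ->
  ((rll_bound p')%:E <= capacity k p)%E.
Proof.
move=> p'0 p'1 pp'; have q0 := coin_ge0 p'0; have q1 := coin_lt1 p'0 p'1.
rewrite -rate_coin //; case: pp' => [p'p|[-> p00]]; last first.
  (* Here the bias is 0 and words of nonzero weight avoid 1^{k+1} altogether, so any tolerance will
     do. *)
  apply: (@capacity_ge_rate _ _ _ _ _ _ 1) => //; rewrite p00 ?coin_ge0 ?coin_lt1 //.
  apply: nearW => n w wn w0 _ _; apply: mem_rll => //.
  by rewrite mul0r (weight_q0_occ _ w0) // /coin !mul0r.
(* The error in the visits, the error in the occurrences and the boundary loss [p * k%:R] each cost
   at most [d * n%:R], which fits in the gap between [p'] and [p]. *)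
pose d := (p - p') / 4; have d0 : 0 < d by rewrite /d; lra.
apply: (@capacity_ge_rate _ _ _ _ _ _ d) => //; near=> n => w wn _ so sv.
apply: mem_rll; first exact: le_trans (ltW p'p).
have kn : p * k%:R <= d * n%:R by near: n; apply: near_infty_mul.
have := pot_ge0 k q1 w; move: so sv.
rewrite !ler_norml /occ_dev /visits_dev wn => /andP[_ so] /andP[_ sv] h0.
have sp : coin p' * stat k (coin p') = p'.
  rewrite stat_coin // /coin; field.
  by rewrite !gt_eqF ?bound_den_gt0 ?pred_expr2S_gt0.
have vle : (visits k w)%:R <= (stat k (coin p') + d) * n%:R by lra.
have := ler_wpM2l q0 vle; rewrite mulrA mulrDr sp => qv.
have dn0 : 0 <= d * n%:R by rewrite mulr_ge0 // ltW.
have : coin p' * d * n%:R <= d * n%:R.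
  by rewrite -mulrA ler_piMl // ltW.
have -> : p = p' + 4 * d by rewrite /d; field.
move: kn; have {1}-> : p = p' + 4 * d by rewrite /d; field.
lra.
Unshelve. all: by end_near. Qed.

Lemma rll_bound_continuous (p : R) : 0 < p -> p < 1 ->
  (rll_bound x @[x --> p] --> rll_bound p)%classic.
Proof.
move=> p0 p1; have D0 := bound_den_gt0 (ltW p0); have M0 := pred_expr2S_gt0.
have cD : (1 + 2 * x * (2 ^+ k - 1) @[x --> p] --> 1 + 2 * p * (2 ^+ k - 1))%classic.
  by apply: cvgD; [exact: cvg_cst|apply: cvgMr_tmp; apply: cvgMl_tmp; exact: cvg_id].
have cDV := cvgV (lt0r_neq0 D0) cD.
rewrite /rll_bound /log2; apply: cvgB; first apply: cvgB; first exact: cvg_cst.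
  apply: cvgM.
    by apply: cvgMr_tmp; apply: cvgB; [exact: cvg_cst|exact: cvg_id].
  apply: cvgMr_tmp; apply: continuous_cvg.
    by apply: continuous_ln; rewrite divr_gt0 //; lra.
  apply: cvgM; last exact: cDV.
  apply: cvgB; first exact: cvg_cst.
  by apply: cvgMl_tmp; exact: cvg_id.
apply: cvgM; first exact: cvg_id.
apply: cvgMr_tmp; apply: continuous_cvg.
  by apply: continuous_ln; rewrite divr_gt0 // !mulr_gt0.
apply: cvgM; last exact: cDV.
by apply: cvgMr_tmp; apply: cvgMl_tmp; exact: cvg_id.
Qed.

End Bound.

Theorem theorem29 (R : realType) (k : nat) (p : R) :
  (1 <= k)%N -> 0 <= p -> p <= 2%:R ^- k.+1 ->
  ((1 - (1 - p) / (2%:R ^+ k.+1 - 1)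
          * log2 ((2%:R - 2%:R * p) / (1 + 2%:R * p * (2%:R ^+ k - 1)))
      - p * log2 (2%:R * p * (2%:R ^+ k.+1 - 1)
                  / (1 + 2%:R * p * (2%:R ^+ k - 1))))%:E
    <= capacity k p)%E.
Proof.
move=> _ p0 pk; rewrite -/(rll_bound k p).
have p1 : p < 1.
  by apply: le_lt_trans pk _; rewrite invf_lt1 ?exprn_gt0 // exprn_egt1 //; lra.
have [p00|pn0] := eqVneq p 0; first by apply: capacity_ge_bound => //; right.
have {pn0}p0 : 0 < p by rewrite lt_neqAle eq_sym pn0.
apply/lee_subgt0Pr => e e0.
have cont : (rll_bound k x @[x --> p^'-] --> rll_bound k p)%classic.
  by apply: cvg_at_left_filter; exact: rll_bound_continuous.
(* A point [x < p] near [p] leaves slack for typical words and lowers the bound by at most [e]. *)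
near (p^'-)%classic => x.
apply: (@le_trans _ _ (rll_bound k x)%:E); last first.
  apply: capacity_ge_bound; first by near: x; exact: nbhs_left_ge.
    by apply: lt_trans p1; near: x; exact: nbhs_left_lt.
  by left; near: x; exact: nbhs_left_lt.
rewrite -EFinB lee_fin; near: x.
by apply: (cvgr_ge _ cont); lra.
Unshelve. all: by end_near. Qed.
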